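(* Fix one of the five cases below. Two bounding pairs $(g,V),(g',V')\in BP_n$ are conjugate under $G_\infty(\mathbb{F}_q)$ if and only if they are conjugate under the subgroup $G_{B_n}(V_n)$.
   Context: Five cases of a standard form $B_n$ on $V_n$: (Hermitian) $V_n=\mathbb{F}_{q^2}^n$, $B_n(x,y)=\sum_{i=1}^nx_iy_i^q$; (alternating) $V_n=\mathbb{F}_q^{2n}$, $B_n=\sum_{i=1}^n(x_{2i-1}y_{2i}-x_{2i}y_{2i-1})$; and, for $q$ odd, (positive symmetric) $V_n=\mathbb{F}_q^{2n}$, $B_n=\sum_{i=1}^n(x_{2i-1}y_{2i}+x_{2i}y_{2i-1})$; (negative symmetric) $V_n=\mathbb{F}_q^{2n}$, $B_n=x_1y_1-\epsilon x_2y_2+\sum_{i=2}^n(x_{2i-1}y_{2i}+x_{2i}y_{2i-1})$ with $\epsilon$ a fixed non-square; (odd symmetric) $V_n=\mathbb{F}_q^{2n+1}$, $B_n=x_1y_1+\sum_{i=1}^n(x_{2i}y_{2i+1}+x_{2i+1}y_{2i})$. $V_n\subset V_{n+1}$ as the initial coordinates, $V_\infty=\varinjlim V_n$ with the induced form $B_\infty$, and $V_n^\perp$ is the orthogonal complement of $V_n$ in $V_\infty$ (spanned by the remaining basis vectors). $G_{B_n}(V_n)$ is the symmetry group $\{g\in GL(V_n):B_n(gv,gw)=B_n(v,w)\}$, viewed inside $G_{B_{n+1}}(V_{n+1})$ by acting as the identity on the new coordinates, and $G_\infty(\mathbb{F}_q)=\varinjlim G_{B_n}(V_n)$. A subspace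 of $V_\infty$ is smooth if it contains $V_n^\perp$ for some $n$. A bounding pair is $(g,V)$ with $g\in G_\infty(\mathbb{F}_q)$ and $V$ a smooth subspace fixed pointwise by $g$; $BP_n$ is the set of bounding pairs with $V\supseteq V_n^\perp$. $G_\infty(\mathbb{F}_q)$ acts by $x\cdot(g,V)=(xgx^{-1},xV)$. *)

(* Defs.v *)
From HB Require Import structures.
From mathcomp Require Import all_boot all_order all_algebra all_field.
Set Implicit Arguments. Unset Strict Implicit. Unset Printing Implicit Defensive.
Import GRing.Theory.
Local Open Scope ring_scope.

Inductive formcase := Herm | Alt | PosSym | NegSym | OddSym.

(* Vectors of V_infinity: sequences of scalars (coordinates 0-indexed:
   paper coordinate x_k is v (k-1)); V_infinity itself is the set of
   finitely supported ones. *)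
Definition vec (K : Type) := nat -> K.

Definition finsupp (K : nzRingType) (v : vec K) : Prop :=
  exists N, forall i, (N <= i)%N -> v i = 0.

Definition dimV (c : formcase) (n : nat) : nat :=
  match c with
  | Herm => n
  | Alt | PosSym | NegSym => n.*2
  | OddSym => n.*2.+1
  end.

Definition case_hyp (c : formcase) (q : nat) (K : finFieldType) (eps : K) : Prop :=
  match c with
  | Herm => #|K| = (q ^ 2)%N
  | Alt => #|K| = q
  | PosSym | OddSym => #|K| = q /\ odd q
  | NegSym => [/\ #|K| = q, odd q & ~ (exists a : K, eps = a * a)]
  end.

Definition Bn (c : formcase) (q : nat) (K : finFieldType) (eps : K) (n : nat)
    (x y : vec K) : K :=
  match c with
  | Herm => \sum_(i < n) x i * y i ^+ q
  | Alt => \sum_(i < n) (x i.*2 * y i.*2.+1 - x i.*2.+1 * y i.*2)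
  | PosSym => \sum_(i < n) (x i.*2 * y i.*2.+1 + x i.*2.+1 * y i.*2)
  | NegSym =>
      if n is 0 then 0 else
      x 0%N * y 0%N - eps * (x 1%N * y 1%N)
      + \sum_(1 <= i < n) (x i.*2 * y i.*2.+1 + x i.*2.+1 * y i.*2)
  | OddSym => x 0%N * y 0%N
      + \sum_(i < n) (x i.*2.+1 * y i.*2.+2 + x i.*2.+2 * y i.*2.+1)
  end.

Definition extend (K : nzRingType) (d : nat) (A : 'M[K]_d) (v : vec K) : vec K :=
  fun i => match (insub i : option 'I_d) with
           | Some i' => \sum_(j < d) A i' j * v j
           | None => v i
           end.

Definition inGBn (c : formcase) (q : nat) (K : finFieldType) (eps : K) (n : nat)
    (A : 'M[K]_(dimV c n)) : Prop :=
  A \in unitmx /\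
  forall v w : vec K,
    Bn c q eps n (extend A v) (extend A w) = Bn c q eps n v w.

Definition inGn (c : formcase) (q : nat) (K : finFieldType) (eps : K) (n : nat)
    (x : vec K -> vec K) : Prop :=
  exists A : 'M[K]_(dimV c n), @inGBn c q K eps n A /\ forall v, x v = extend A v.

Definition inGinf (c : formcase) (q : nat) (K : finFieldType) (eps : K)
    (x : vec K -> vec K) : Prop :=
  exists n, inGn c q eps n x.

Definition subspace (K : finFieldType) (V : vec K -> Prop) : Prop :=
  [/\ forall v, V v -> finsupp v,
      V (fun _ => 0),
      forall v w, V v -> V w -> V (fun i => v i + w i)
    & forall (a : K) v, V v -> V (fun i => a * v i)].

(* V contains V_n^perp (finitely supported vectors vanishing on the first
   dim V_n coordinates). *)
Definition contains_perp (c : formcase) (K : finFieldType) (n : nat)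
    (V : vec K -> Prop) : Prop :=
  forall v, finsupp v -> (forall i, (i < dimV c n)%N -> v i = 0) -> V v.

Definition smooth (c : formcase) (K : finFieldType) (V : vec K -> Prop) : Prop :=
  subspace V /\ exists n, @contains_perp c K n V.

Definition bounding_pair (c : formcase) (q : nat) (K : finFieldType) (eps : K)
    (g : vec K -> vec K) (V : vec K -> Prop) : Prop :=
  [/\ inGinf c q eps g, @smooth c K V & forall v, V v -> g v = v].

Definition inBP (c : formcase) (q : nat) (K : finFieldType) (eps : K) (n : nat)
    (g : vec K -> vec K) (V : vec K -> Prop) : Prop :=
  bounding_pair c q eps g V /\ @contains_perp c K n V.

Definition acts_to (K : finFieldType) (x : vec K -> vec K)
    (g : vec K -> vec K) (V : vec K -> Prop)
    (g' : vec K -> vec K) (V' : vec K -> Prop) : Prop :=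
  exists xinv : vec K -> vec K,
    [/\ forall v, xinv (x v) = v,
        forall v, x (xinv v) = v,
        forall v, g' v = x (g (xinv v))
      & forall w, V' w <-> exists v, V v /\ w = x v].

(* Main.v *)
(** U = the orthogonal complement of V in V_n contains the image of g - 1, and if x conjugates (g,V) to
    (g',V') then x maps U isometrically onto the analogous U' inside V_n.  By Witt's extension theorem some y
    in G_n agrees with x on U.  Taking complements gives yV = V'; moreover y - x maps into the complement
    of U', that is into V', which g' fixes, whence y (g - 1) = x (g - 1) = (g' - 1) x = (g' - 1) y.

    Witt's theorem, for a nondegenerate trace-valued e-hermitian form, is proved by extending one vector
    at a time: an isometry fixing H must send u to u + p, where p is orthogonal to H.  If (u,p) <> 0 a
    quasi-reflection along p does it; otherwise p is isotropic, and one uses an Eichler transformation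
    when u is not in H + <p>, and a scaling of a hyperbolic plane containing p when it is. *)

From HB Require Import structures.
Require Import Defs.
From mathcomp Require Import all_boot all_order all_algebra all_field.
From mathcomp Require Import ring zify.
From Stdlib Require Import Classical FunctionalExtensionality.
Set Implicit Arguments. Unset Strict Implicit. Unset Printing Implicit Defensive.
Import GRing.Theory.
Local Open Scope ring_scope.

(** * Witt's extension theorem *)

Section Witt.

Variables (K : fieldType) (s : {rmorphism K -> K}) (e : K) (d : nat).
Variable J : 'M[K]_d.
Hypothesis sK : involutive s.
Hypothesis ee : e * e = 1.
Hypothesis se : s e = e.
Hypothesis J_unit : J \in unitmx.

Definition gram k l (A : 'M[K]_(k, d)) (C : 'M[K]_(l, d)) : 'M[K]_(k, l) :=
  A *m J *m (map_mx s C)^T.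

Definition form (x y : 'rV[K]_d) : K := gram x y 0 0.

Hypothesis formC : forall x y, form y x = e * s (form x y).
(** Trace-valuedness keeps the argument valid in characteristic 2: it provides the scalars that
    cancel [form a a] in the Eichler step and make a dual vector isotropic in the scaling step. *)
Hypothesis form_trace : forall x, exists t, form x x = t + e * s t.

Lemma gramE k l (A : 'M[K]_(k, d)) (C : 'M[K]_(l, d)) i j :
  gram A C i j = form (row i A) (row j C).
Proof.
rewrite /form /gram -row_mul [LHS]mxE [RHS]mxE.
by apply: eq_bigr => k' _; rewrite !mxE.
Qed.

Lemma formDl x y z : form (x + y) z = form x z + form y z.
Proof. by rewrite /form /gram !mulmxDl mxE. Qed.

Lemma formZl a x z : form (a *: x) z = a * form x z.
Proof. by rewrite /form /gram -!scalemxAl mxE. Qed.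

Lemma formDr x y z : form z (x + y) = form z x + form z y.
Proof. by rewrite /form /gram raddfD /= raddfD /= mulmxDr mxE. Qed.

Lemma formZr a x z : form z (a *: x) = s a * form z x.
Proof. by rewrite /form /gram map_mxZ linearZ /= -scalemxAr mxE. Qed.

(** * Isometries built from maps of rank one *)

Definition rank1 (a v : 'rV[K]_d) : 'M[K]_d := J *m (map_mx s a)^T *m v.

Lemma mul_rank1 x a v : x *m rank1 a v = form x a *: v.
Proof. by rewrite /rank1 2!mulmxA [X in X *m v]mx11_scalar mul_scalar_mx. Qed.

Lemma mul_rank1_eq0 k (H : 'M[K]_(k, d)) a v : gram H a = 0 -> H *m rank1 a v = 0.
Proof. by rewrite /rank1 2!mulmxA => Ha; rewrite -[_ *m _^T]/(gram H a) Ha mul0mx. Qed.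

Definition isometry (T : 'M[K]_d) := forall x y, form (x *m T) (y *m T) = form x y.

(** The Gram matrix [J] of the standard basis is unchanged by [T] and invertible, so taking
    determinants suffices. *)
Lemma isometry_unit T : isometry T -> T \in unitmx.
Proof.
move=> hT; have TJ : gram T T = J.
  apply/matrixP=> i j; rewrite gramE !rowE hT /form /gram -rowE map_delta_mx.
  by rewrite trmx_delta -colE !mxE.
have : \det (gram T T) \is a GRing.unit by rewrite TJ -unitmxE.
by rewrite /gram !det_mulmx unitrM unitrM -unitmxE => /andP[/andP[]].
Qed.

(** Some column of [cokermx A] is a functional that kills [A] but not [u]. Nondegeneracy represents
    it as pairing with a vector; as [s] is an involution, applying it in advance undoes the
    conjugation in the second argument. *)
Lemma gram_dual k (A : 'M[K]_(k, d)) u :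
  ~~ (u <= A)%MS -> exists a, gram A a = 0 /\ form u a = 1.
Proof.
rewrite submxE => /rV0Pn[j uj0].
set c := (u *m cokermx A) 0 j in uj0.
exists (map_mx s (c^-1 *: (invmx J *m col j (cokermx A)))^T).
have gramE' l (M : 'M_(l, d)) : gram M (map_mx s (c^-1 *: (invmx J *m col j (cokermx A)))^T)
    = c^-1 *: (M *m col j (cokermx A)).
  rewrite /gram -map_mx_comp map_mx_id; last by move=> x; rewrite /= sK.
  by rewrite trmxK -mulmxA -scalemxAr mulKVmx // -scalemxAr.
split; first by rewrite gramE' colE mulmxA mulmx_coker mul0mx scaler0.
by rewrite /form gramE' mxE colE mulmxA -colE [X in _ * X]mxE mulVf.
Qed.

Lemma gram_isometry T k l (A : 'M[K]_(k, d)) (C : 'M[K]_(l, d)) :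
  isometry T -> gram (A *m T) (C *m T) = gram A C.
Proof. by move=> hT; apply/matrixP=> i j; rewrite !gramE !row_mul hT. Qed.

Lemma isometry_comp T T' : isometry T -> isometry T' -> isometry (T *m T').
Proof. by move=> hT hT' x y; rewrite !mulmxA hT' hT. Qed.

(** The map is x -> x + c(x,p)p, and the hypothesis is the vanishing of the coefficient of
    (x,p)s(y,p) in the change of the form. *)
Lemma quasi_reflection p c :
  e * c + s c + c * s c * form p p = 0 -> isometry (1%:M + rank1 p (c *: p)).
Proof.
move=> hc x y; rewrite !mulmxDr !mulmx1 !mul_rank1 !scalerA.
rewrite !formDl !formDr !formZl !formZr (formC y p) !rmorphM.
apply/eqP; rewrite -subr_eq0; apply/eqP.
transitivity (form x p * s (form y p) * (e * c + s c + c * s c * form p p)); last by rewrite hc mulr0.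
by ring.
Qed.

(** The Eichler map x -> x + (x,a)p - e(x,p)a + m(x,p)p fixes all vectors orthogonal to [a] and [p];
    the term in [m] compensates for (a,a). *)
Lemma eichler p a m : form p p = 0 -> form p a = 0 ->
  e * m + s m + form a a = 0 ->
  isometry (1%:M + rank1 a p + rank1 p (- e *: a + m *: p)).
Proof.
move=> pp pa hm x y; have ap : form a p = 0 by rewrite formC pa rmorph0 mulr0.
rewrite !mulmxDr !mulmx1 !mul_rank1.
rewrite !(formDl, formDr, formZl, formZr) pp pa ap (formC y p) (formC y a).
rewrite rmorphN se.
apply/eqP; rewrite -subr_eq0; apply/eqP.
transitivity (form x p * s (form y p) * (e * m + s m + (e * e) * form a a)
  + (form x p * s (form y a) * (1 - e * e))); last by rewrite ee mul1r hm subrr !mulr0 addr0.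
by ring.
Qed.

(** This map multiplies [p] by m and [r] by the inverse of s(m), and fixes the complement of their
    hyperbolic plane. *)
Lemma hyperbolic_scaling p r m : form p p = 0 -> form r r = 0 -> form p r = 1 -> m != 0 ->
  isometry (1%:M + rank1 r ((m - 1) *: p) + rank1 p ((e * ((s m)^-1 - 1)) *: r)).
Proof.
move=> pp rr pr m0 x y; have rp : form r p = e by rewrite formC pr rmorph1 mulr1.
have sm0 : s m != 0 by rewrite fmorph_eq0.
rewrite !mulmxDr !mulmx1 !mul_rank1.
rewrite !(formDl, formDr, formZl, formZr) pp rr pr rp (formC y p) (formC y r).
rewrite !rmorphM !rmorphB fmorphV sK rmorph1 se.
apply/eqP; rewrite -subr_eq0; apply/eqP.
transitivity ((e * e - 1) * (form x p * s (form y r) * (1 - s m))); last by rewrite ee subrr mul0r.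
by field; rewrite m0.
Qed.

(** * Extending an isometry by one vector, then by a basis *)

Lemma witt_step k (H : 'M[K]_(k, d)) u w :
  ~~ (u <= H)%MS -> ~~ (w <= H)%MS -> gram H u = gram H w -> form u u = form w w ->
  exists T, [/\ isometry T, H *m T = H & u *m T = w].
Proof.
have [p ->] : exists p, w = u + p by exists (w - u); rewrite addrC subrK.
move=> uH wH Hup uup.
have Hp : gram H p = 0.
  move: Hup; rewrite /gram raddfD /= raddfD /= mulmxDr => /eqP.
  by rewrite eq_sym -subr_eq0 addrC addKr => /eqP.
have fixH c : gram H (c *: p) = 0.
  by rewrite /gram map_mxZ linearZ /= -scalemxAr -[_ *m _^T]/(gram H p) Hp scaler0.
have {}uup : form p u + form u p + form p p = 0.
  apply: (addrI (form u u)); rewrite addr0 [RHS]uup !(formDl, formDr); ring.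
have [up0|up0] := eqVneq (form u p) 0; last first.
  (* With c the inverse of (u,p), u + c(u,p)p = u + p; the condition on c is [uup] divided by
     (u,p)s(u,p). *)
  exists (1%:M + rank1 p ((form u p)^-1 *: p)); split.
  - apply: quasi_reflection; move: uup.
    have su0 : s (form u p) != 0 by rewrite fmorph_eq0.
    rewrite fmorphV (formC u p) => uup; rewrite -[RHS](mulr0 ((form u p)^-1 / s (form u p))) -uup.
    by field; rewrite su0.
  - by rewrite mulmxDr mulmx1 mul_rank1_eq0 // addr0.
  - by rewrite mulmxDr mulmx1 mul_rank1 scalerA mulfV // scale1r.
have pu0 : form p u = 0 by rewrite formC up0 rmorph0 mulr0.
have {uup} pp0 : form p p = 0 by rewrite up0 pu0 !add0r in uup.
have [uHp|uHp] := boolP (u <= col_mx p H)%MS; last first.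
  (* The dual vector [a] is orthogonal to [p] and [H], with (u,a) = 1; since (u,p) = 0, the Eichler
     map adds exactly [p] to [u]. *)
  have [a [/colP ga ua]] := gram_dual uHp.
  have Ha : gram H a = 0.
    apply/colP=> i; have := ga (rshift 1 i).
    by rewrite /gram !mul_col_mx col_mxEd [RHS]mxE => ->; rewrite mxE.
  have pa : form p a = 0.
    by have := ga (lshift k 0); rewrite /gram !mul_col_mx col_mxEu [RHS]mxE.
  have [t ht] := form_trace a.
  exists (1%:M + rank1 a p + rank1 p (- e *: a + (- (e * t)) *: p)); split.
  - apply: eichler => //; rewrite ht rmorphN rmorphM se.
    rewrite mulrN mulrA ee mul1r; ring.
  - by rewrite !mulmxDr mulmx1 !mul_rank1_eq0 // !addr0.
  - by rewrite !mulmxDr mulmx1 !mul_rank1 ua up0 scale1r scale0r addr0.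
have /submxP[D uE] := uHp.
have {D uE} [h hH [c uE]] : exists2 h, (h <= H)%MS & exists c, u = c *: p + h.
  exists (rsubmx D *m H); first exact: submxMl.
  exists (lsubmx D 0 0); rewrite {1}uE -{1}[D]hsubmxK mul_row_col.
  by rewrite [X in X *m p]mx11_scalar mul_scalar_mx.
(* Here u = cp + h and w = (c + 1)p + h both lie outside [H], so neither c nor c + 1 vanishes. *)
have c0 : c != 0 by apply: contraNneq uH => c0; rewrite uE c0 scale0r add0r.
have c10 : c + 1 != 0.
  apply: contraNneq wH => c10; rewrite uE addrAC -[X in _ + X + _]scale1r.
  by rewrite -scalerDl c10 scale0r add0r.
have pH : ~~ (p <= H)%MS.
  by apply: contraNN uH => pH; rewrite uE addmx_sub // scalemx_sub.
have [r [Hr pr]] := gram_dual pH.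
have [t ht] := form_trace r.
have rp : form r p = e by rewrite formC pr rmorph1 mulr1.
(* Subtracting tp makes [r] isotropic and keeps its pairings with [p] and [H]. *)
pose r' := r + (- t) *: p.
have Hr' : gram H r' = 0.
  by rewrite /gram raddfD /= raddfD /= mulmxDr -!/(gram _ _) Hr fixH addr0.
have pr' : form p r' = 1 by rewrite formDr formZr pp0 mulr0 addr0.
have rr' : form r' r' = 0.
  rewrite !(formDl, formDr, formZl, formZr) pp0 pr rp ht rmorphN; ring.
(* Scaling [p] by this factor while fixing h turns cp + h into (c + 1)p + h. *)
pose m := (c + 1) / c.
exists (1%:M + rank1 r' ((m - 1) *: p) + rank1 p ((e * ((s m)^-1 - 1)) *: r')); split.
- by apply: hyperbolic_scaling => //; rewrite mulf_neq0 ?invr_eq0.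
- by rewrite !mulmxDr mulmx1 !mul_rank1_eq0 // !addr0.
- rewrite !mulmxDr mulmx1 !mul_rank1 up0 scale0r addr0 scalerA.
  have hr' : form h r' = 0.
    by case/submxP: hH => D ->; rewrite /form /gram -!mulmxA (mulmxA H) -/(gram H r') Hr' mulmx0 mxE.
  rewrite {2}uE formDl formZl pr' hr' addr0 mulr1; congr (_ + _).
  by rewrite /m mulrBr mulr1 mulrCA mulfV // mulr1 addrC addKr scale1r.
Qed.

(** Induction on the number of rows: once [T] matches all rows but the first, [witt_step] fixes
    their images and moves the image of the first row to its target. *)
Theorem witt_extension k (U W : 'M[K]_(k, d)) :
  row_free U -> row_free W -> gram U U = gram W W ->
  exists T, isometry T /\ U *m T = W.
Proof.
elim: k U W => [|k IH] U W.
  move=> _ _ _; exists 1%:M; split; last by apply/matrixP=> - [].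
  by move=> x y; rewrite !mulmx1.
rewrite -[k.+1]/(1 + k)%N in U W *.
rewrite -[U]vsubmxK -[W]vsubmxK; move: (usubmx U) (dsubmx U) (usubmx W) (dsubmx W) => {U W} u H w L.
have free_col (x : 'rV[K]_d) (A : 'M[K]_(k, d)) : row_free (col_mx x A) -> row_free A /\ ~~ (x <= A)%MS.
  rewrite -!row_leq_rank -addsmxE => xA; split.
    have := mxrank_adds_leqif x A; have := rank_leq_row x => h1 [h2 _].
    by rewrite -(leq_add2l 1); apply: leq_trans xA (leq_trans h2 _); rewrite leq_add2r.
  apply/negP => xsA; have := addsmx_idPr xsA => [[h _]].
  by have := rank_leq_row A; rewrite -h leqNgt => /negP; apply.
move=> /free_col[Hf uH] /free_col[Lf wL] G.
move: G; rewrite {1 2}/gram !mul_col_mx !map_col_mx !tr_col_mx !mul_mx_row.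
move=> /eq_col_mx[/eq_row_mx[uu _] /eq_row_mx[Hu HH]].
have [T [hT HT]] := IH H L Hf Lf HH.
have [||||S [hS LS uS]] := @witt_step k L (u *m T) w.
- by rewrite -HT submxMfree // row_free_unit isometry_unit.
- by [].
- by rewrite -HT gram_isometry // HT.
- by rewrite hT /form /gram uu.
exists (T *m S); split; first exact: isometry_comp.
by rewrite mul_col_mx !mulmxA uS HT LS.
Qed.

(** * Orthogonal complements of row spaces *)

Definition perp k (A : 'M[K]_(k, d)) : 'M[K]_d := kermx (J *m (map_mx s A)^T).

Lemma sub_perp k l (A : 'M[K]_(k, d)) (C : 'M[K]_(l, d)) :
  (C <= perp A)%MS = (gram C A == 0).
Proof. by rewrite /perp sub_kermx mulmxA. Qed.

Lemma gram_eq0C k l (A : 'M[K]_(k, d)) (C : 'M[K]_(l, d)) :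
  gram C A = 0 -> gram A C = 0.
Proof.
move=> CA; apply/matrixP=> i j.
by rewrite gramE formC -gramE CA !mxE rmorph0 mulr0.
Qed.

Lemma rank_perp k (A : 'M[K]_(k, d)) : \rank (perp A) = (d - \rank A)%N.
Proof.
rewrite mxrank_ker -mxrank_tr trmx_mul trmxK mxrankMfree ?mxrank_map //.
by rewrite row_free_unit unitmx_tr.
Qed.

(** One inclusion is the symmetry of orthogonality; equality follows by counting dimensions. *)
Lemma perpK k (A : 'M[K]_(k, d)) : (perp (perp A) :=: A)%MS.
Proof.
apply/eqmx_sym/eqmxP; rewrite -mxrank_leqif_eq.
  by rewrite !rank_perp subKn // rank_leq_col.
by rewrite sub_perp; apply/eqP/gram_eq0C/eqP; rewrite -sub_perp.
Qed.

End Witt.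

(** * The five standard forms *)

Definition pairing (i : nat) : nat := if odd i then i.-1 else i.+1.

(* In the form of case [c], coordinate [i] is paired with coordinate [partner c i] only. *)
Definition partner (c : formcase) (i : nat) : nat :=
  match c with
  | Herm => i
  | Alt | PosSym => pairing i
  | NegSym => if (i < 2)%N then i else pairing i
  | OddSym => if i is j.+1 then (pairing j).+1 else 0%N
  end.

Lemma pairingK : involutive pairing.
Proof. by rewrite /pairing => i; case: ifP; case: ifP; lia. Qed.

Lemma pairing_lt i n : (pairing i < n.*2)%N = (i < n.*2)%N.
Proof. by rewrite /pairing; case: ifP; lia. Qed.

Lemma partnerK c : involutive (partner c).
Proof.
case: c => i //=; rewrite ?pairingK //; last by case: i => //= i; rewrite pairingK.
have h := pairing_lt i 1; rewrite -[1.*2%N]/2%N in h.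
by case: (boolP (i < 2)%N) => [->//|i2]; rewrite h (negPf i2) pairingK.
Qed.

Lemma partner_lt c i n : (partner c i < dimV c n)%N = (i < dimV c n)%N.
Proof.
case: c => //=; rewrite ?pairing_lt //; last first.
  by case: i => //= i; rewrite ltnS pairing_lt.
by case: ifP => // _; rewrite pairing_lt.
Qed.

Lemma leq_dimV c n m : (n <= m)%N -> (dimV c n <= dimV c m)%N.
Proof. by case: c => //= h; rewrite ?ltnS ?leq_double. Qed.

Section Form.

Variables (K : finFieldType) (c : formcase) (q : nat) (eps : K).

(** With [partner] and [conj_of], these scalars bring all five forms to the single shape of
    [BnE]. *)
Definition coef (i : nat) : K :=
  match c with
  | Alt => if odd i then -1 else 1
  | NegSym => if i == 1%N then - eps else 1
  | _ => 1
  end.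

Definition conj_of (a : K) : K := if c is Herm then a ^+ q else a.

Lemma BnE n x y : Bn c q eps n x y =
  \sum_(0 <= i < dimV c n) coef i * x i * conj_of (y (partner c i)).
Proof.
rewrite /coef /conj_of; case: c => /=.
- by rewrite big_mkord; apply: eq_bigr => i _; rewrite mul1r.
- elim: n => [|n IH]; first by rewrite big_ord0 big_nil.
  rewrite big_ord_recr IH doubleS !big_nat_recr //= /pairing /= odd_double /=; ring.
- elim: n => [|n IH]; first by rewrite big_ord0 big_nil.
  rewrite big_ord_recr IH doubleS !big_nat_recr //= /pairing /= odd_double /=; ring.
- case: n => [|n]; first by rewrite big_nil.
  elim: n => [|n IH]; first by rewrite big_nil !big_nat_recr //= big_nil; ring.
  rewrite big_nat_recr //= addrA IH [in RHS]doubleS !big_nat_recr //= /pairing /= odd_double /=; ring.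
- rewrite big_nat_recl // mul1r; congr (_ + _).
  elim: n => [|n IH]; first by rewrite big_ord0 big_nil.
  rewrite big_ord_recr IH doubleS !big_nat_recr //= /pairing /= odd_double /=; ring.
Qed.

Lemma Bn_linear n a x y z :
  Bn c q eps n (fun i => a * x i + y i) z = a * Bn c q eps n x z + Bn c q eps n y z.
Proof.
by rewrite !BnE mulr_sumr -big_split; apply: eq_bigr => i _ /=; ring.
Qed.

Lemma Bn_split n m x y : (n <= m)%N -> Bn c q eps m x y = Bn c q eps n x y
  + \sum_(dimV c n <= i < dimV c m) coef i * x i * conj_of (y (partner c i)).
Proof. by move=> nm; rewrite !BnE -big_cat_nat ?leq_dimV. Qed.

Lemma Bn_supp n m x y : (n <= m)%N -> (forall i, (dimV c n <= i)%N -> x i = 0) ->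
  Bn c q eps m x y = Bn c q eps n x y.
Proof.
move=> nm hx; rewrite (Bn_split _ _ nm) [X in _ + X]big_nat_cond big1 ?addr0 //.
by move=> i /andP[/andP[h _] _]; rewrite hx // mulr0 mul0r.
Qed.

Hypothesis hyp : case_hyp c q eps.

(** With [coef_neq0], this is nondegeneracy in coordinates: each coordinate is read off by one basis
    vector. *)
Lemma Bn_partner n x i : (i < dimV c n)%N ->
  Bn c q eps n x (fun j => (j == partner c i)%:R) = coef i * x i.
Proof.
move=> ilt; have conj1 : conj_of 1 = 1 by rewrite /conj_of; case: c; rewrite // expr1n.
have conj0 : conj_of 0 = 0.
  move: hyp; rewrite /conj_of; case: c => //= h; rewrite expr0n.
  (* Since [0 ^+ 0] is 1, the value q = 0 must be excluded; it would make the field empty. *)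
  by case: q h => // h; have := finNzRing_gt1 K; rewrite h.
rewrite BnE (bigD1_seq i) ?mem_index_iota ?iota_uniq //= eqxx conj1 mulr1.
rewrite big1 ?addr0 // => j ji; rewrite (can_eq (@partnerK c)) (negPf ji).
by rewrite conj0 mulr0.
Qed.

Lemma coef_neq0 i : coef i != 0.
Proof.
rewrite /coef; move: hyp; case: c => //=; rewrite ?oner_eq0 //.
  by case: ifP; rewrite ?oppr_eq0 oner_eq0.
case=> _ _ h; case: ifP => _; rewrite ?oner_eq0 // oppr_eq0.
(* A zero [eps] would be the square of 0. *)
by apply/negP=> /eqP e0; apply: h; exists 0; rewrite mulr0.
Qed.

End Form.

(** * Finite fields and the symmetry type of the forms *)

Lemma two_neq0 (K : finFieldType) : odd #|K| -> 2%:R != 0 :> K.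
Proof.
move=> oK; apply/negP=> K2.
have ch : 2%N \in [pchar K] by rewrite inE /= K2.
have := card_pprimeChar ch; rewrite /pPrimeCharType => hK.
have := finNzRing_gt1 K; move: oK; rewrite hK oddX /= orbF => /eqP->.
by rewrite expn0.
Qed.

Lemma pnat_card (K : finFieldType) : ([pchar K]).-nat #|K|.
Proof.
have [p pr ch] := finPcharP K.
have := card_pprimeChar ch; rewrite /pPrimeCharType => ->.
by rewrite (eq_pnat _ (pcharf_eq ch)) pnatX pnat_id.
Qed.

Lemma power_rmorphism (K : finFieldType) q : ([pchar K]).-nat q ->
  exists s : {rmorphism K -> K}, forall a, s a = a ^+ q.
Proof.
move=> hq; pose f (a : K) := a ^+ q.
have fB : zmod_morphism f.
  by move=> a b; rewrite /f exprDn_pchar // exprNn_pchar.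
have fM : monoid_morphism f by split=> [|a b]; rewrite /f ?expr1n ?exprMn.
pose A := GRing.isZmodMorphism.Build K K f fB.
pose M := GRing.isMonoidMorphism.Build K K f fM.
by exists (HB.pack f A M : {rmorphism K -> K}).
Qed.

(** Otherwise X^q + X, of degree q, would vanish at all q^2 elements of the field. *)
Lemma exists_trace_neq0 (K : finFieldType) q :
  #|K| = (q ^ 2)%N -> exists t : K, t + t ^+ q != 0.
Proof.
move=> hK; have q1 : (1 < q)%N.
  by have := finNzRing_gt1 K; rewrite hK; case: q {hK} => [|[]].
apply: NNPP => h.
have := @max_poly_roots K ('X^q + 'X) (enum K).
have sz : size ('X^q + 'X : {poly K}) = q.+1.
  by rewrite size_polyDl ?size_polyXn ?size_polyX.
rewrite sz -size_poly_eq0 sz -cardE hK enum_uniq => /(_ isT) h'.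
have : (q ^ 2 < q.+1)%N; last by nia.
apply: h' => //; apply/allP=> t _; rewrite /root !hornerE addrC.
by apply/negPn/negP=> t0; apply: h; exists t.
Qed.

(** [s] is x -> x^q in the Hermitian case and the identity otherwise; e is -1 for the alternating
    form and 1 for the others. Symmetric forms are trace-valued by halving, the alternating one
    because (x,x) = 0. *)
Lemma form_structure (c : formcase) q (K : finFieldType) (eps : K) :
  case_hyp c q eps -> exists (s : {rmorphism K -> K}) (e : K),
  [/\ involutive s, e * e = 1 /\ s e = e,
      forall a, conj_of c q a = s a,
      forall n x y, Bn c q eps n y x = e * s (Bn c q eps n x y)
    & forall n x, exists t, Bn c q eps n x x = t + e * s t].
Proof.
have half x : odd #|K| -> exists t : K, x = t + 1 * t.
  by move=> /two_neq0 K2; exists (x / 2%:R); field.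
case: c => /= hyp.
- have hq : ([pchar K]).-nat q.
    by have := pnat_card K; rewrite hyp pnatX orbF.
  have [s sE] := power_rmorphism hq.
  have sK : involutive s by move=> a; rewrite !sE -exprM mulnn -hyp expf_card.
  have [u u0] := exists_trace_neq0 hyp; rewrite -sE in u0.
  have C n x y : Bn Herm q eps n y x = 1 * s (Bn Herm q eps n x y).
    rewrite mul1r rmorph_sum; apply: eq_bigr => i _.
    by rewrite rmorphM -!sE sK mulrC.
  exists s, 1; split=> //; first by rewrite rmorph1 mul1r.
  move=> n x; have := C n x x; rewrite /=; move: (\sum_(i < n) _) => b; rewrite mul1r => bs.
  (* As b = (x,x) is fixed by [s], multiplying it by u/(u + s(u)) gives an element of trace b. *)
  exists (b * u / (u + s u)); rewrite mul1r !rmorphM fmorphV rmorphD sK -bs.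
  by field; rewrite addrC.
- exists idfun, (-1); split=> //; first by split; rewrite ?rmorphN /=; ring.
    move=> n x y; rewrite mulN1r /= -sumrN; apply: eq_bigr => i _; ring.
  by move=> n x; exists 0; rewrite big1 => [|i _] /=; ring.
- case: hyp => hK oq; rewrite -hK in oq.
  exists idfun, 1; split=> //; first by split; rewrite ?rmorph1 /=; ring.
    move=> n x y; rewrite mul1r /=; apply: eq_bigr => i _; ring.
  by move=> n x; apply: half.
- case: hyp => hK oq _; rewrite -hK in oq.
  exists idfun, 1; split=> //; first by split; rewrite ?rmorph1 /=; ring.
    move=> [|n] x y; rewrite mul1r //=; congr (_ + _); first ring.
    by apply: eq_bigr => i _; ring.
  by move=> n x; apply: half.
- case: hyp => hK oq; rewrite -hK in oq.
  exists idfun, 1; split=> //; first by split; rewrite ?rmorph1 /=; ring.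
    move=> n x y; rewrite mul1r /=; congr (_ + _); first ring.
    by apply: eq_bigr => i _; ring.
  by move=> n x; apply: half.
Qed.

(** * Coordinates *)

Lemma extend_lt (K : nzRingType) d (A : 'M[K]_d) v (i : 'I_d) :
  extend A v i = \sum_(j < d) A i j * v j.
Proof. by rewrite /extend valK. Qed.

Lemma extend_ge (K : nzRingType) d (A : 'M[K]_d) v i : (d <= i)%N -> extend A v i = v i.
Proof. by move=> di; rewrite /extend insubF // ltnNge di. Qed.

Lemma eq_vec (K : Type) d (v w : vec K) :
  (forall i : 'I_d, v i = w i) -> (forall i, (d <= i)%N -> v i = w i) -> v = w.
Proof.
move=> lo hi; apply: functional_extensionality => i.
by have [id|/hi//] := ltnP i d; apply: (lo (Ordinal id)).
Qed.

Lemma extend_linear (K : comNzRingType) d (A : 'M[K]_d) a v w :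
  extend A (fun i => a * v i + w i) = fun i => a * extend A v i + extend A w i.
Proof.
apply: (@eq_vec _ d) => i; last by move=> di; rewrite !extend_ge.
rewrite !extend_lt mulr_sumr -big_split; apply: eq_bigr => j _ /=; ring.
Qed.

Lemma extend_id (K : nzRingType) d (A : 'M[K]_d) v :
  (forall i, (i < d)%N -> v i = 0) -> extend A v = v.
Proof.
move=> v0; apply: (@eq_vec _ d) => i; last exact: extend_ge.
by rewrite extend_lt v0 // big1 // => j _; rewrite v0 ?mulr0.
Qed.

Definition row_of (K : Type) d (v : vec K) : 'rV[K]_d := \row_i v i.

Definition vec_of (K : nzRingType) d (r : 'rV[K]_d) : vec K :=
  fun i => if (insub i : option 'I_d) is Some j then r 0 j else 0.

Lemma vec_of_lt (K : nzRingType) d (r : 'rV[K]_d) (i : 'I_d) : vec_of r i = r 0 i.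
Proof. by rewrite /vec_of valK. Qed.

Lemma vec_of_ge (K : nzRingType) d (r : 'rV[K]_d) i : (d <= i)%N -> vec_of r i = 0.
Proof. by move=> di; rewrite /vec_of insubF // ltnNge di. Qed.

Lemma vec_ofK (K : nzRingType) d : cancel (@vec_of K d) (@row_of K d).
Proof. by move=> r; apply/rowP=> i; rewrite mxE vec_of_lt. Qed.

Lemma row_ofK (K : nzRingType) d (v : vec K) :
  (forall i, (d <= i)%N -> v i = 0) -> vec_of (row_of d v) = v.
Proof.
move=> v0; apply: (@eq_vec _ d) => i; first by rewrite vec_of_lt mxE.
by move=> di; rewrite vec_of_ge // v0.
Qed.

Lemma vec_of_linear (K : nzRingType) d a (r r' : 'rV[K]_d) :
  vec_of (a *: r + r') = fun i => a * vec_of r i + vec_of r' i.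
Proof.
apply: (@eq_vec _ d) => i; first by rewrite !vec_of_lt !mxE.
by move=> di; rewrite !vec_of_ge // mulr0 addr0.
Qed.

Lemma row_of_linear (K : nzRingType) d a (v w : vec K) :
  row_of d (fun i => a * v i + w i) = a *: row_of d v + row_of d w.
Proof. by apply/rowP=> i; rewrite !mxE. Qed.

(** [extend] multiplies columns while Witt's theorem above acts on rows, hence the transpose. *)
Lemma row_of_extend (K : comNzRingType) d (T : 'M[K]_d) v :
  row_of d (extend T^T v) = row_of d v *m T.
Proof.
apply/rowP=> i; rewrite !mxE extend_lt; apply: eq_bigr => j _.
by rewrite !mxE mulrC.
Qed.

Lemma extend_trK (K : comNzRingType) d (T S : 'M[K]_d) v :
  T *m S = 1%:M -> extend S^T (extend T^T v) = v.
Proof.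
move=> TS; apply: (@eq_vec _ d) => i; last by move=> di; rewrite !extend_ge.
have rE : row_of d (extend S^T (extend T^T v)) = row_of d v.
  by rewrite !row_of_extend -mulmxA TS mulmx1.
by have := congr1 (fun r : 'rV_d => r 0 i) rE; rewrite /= !mxE.
Qed.

(** [V] is a mere predicate, so a spanning matrix is grown: while some vector of [V] lies outside
    the row space, it is added. The rank is bounded by [d], so this stops. *)
Lemma subspace_matrix (K : finFieldType) d (V : vec K -> Prop) : subspace V ->
  exists M : 'M[K]_d, forall r : 'rV_d, V (vec_of r) <-> (r <= M)%MS.
Proof.
case=> _ V0 VD VZ.
have Vlin a (r r' : 'rV[K]_d) :
    V (vec_of r) -> V (vec_of r') -> V (vec_of (a *: r + r')).
  by move=> hr hr'; rewrite vec_of_linear; apply: VD => //; apply: VZ.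
have V0' : V (vec_of (0 : 'rV[K]_d)).
  suff -> : vec_of (0 : 'rV[K]_d) = fun=> 0 by [].
  by apply: (@eq_vec _ d) => [i|i /vec_of_ge->//]; rewrite vec_of_lt mxE.
suff grow k (M : 'M[K]_d) : (d - \rank M <= k)%N ->
    (forall r : 'rV_d, (r <= M)%MS -> V (vec_of r)) ->
    exists M' : 'M[K]_d, forall r : 'rV_d, V (vec_of r) <-> (r <= M')%MS.
  by apply: (grow _ 0 (leqnn _)) => r /submx0null->.
elim: k M => [|k IH] M rM MV.
  exists M => r; split=> [_|]; last exact: MV.
  by rewrite submx_full // -col_leq_rank -subn_eq0 -leqn0.
have [[v [Vv vM]]|full] := classic (exists v : 'rV_d, V (vec_of v) /\ ~ (v <= M)%MS).
  apply: (IH (M + v)%MS).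
    suff : (\rank M < \rank (M + v)%MS)%N by lia.
    by apply: rank_ltmx; rewrite ltmxE addsmxSl addsmx_sub submx_refl /=; apply/negP.
  move=> r /sub_addsmxP[[D E] /= ->]; rewrite addrC [X in X *m v]mx11_scalar mul_scalar_mx.
  by apply: Vlin => //; apply: MV; apply: submxMl.
exists M => r; split=> [hr|]; last exact: MV.
by apply/negPn/negP=> /negP rM'; apply: full; exists r.
Qed.

(** * Orthogonal complements and descent to V_n *)

Section StandardForm.

Variables (K : finFieldType) (c : formcase) (q : nat) (eps : K).
Hypothesis hyp : case_hyp c q eps.
Variables (s : {rmorphism K -> K}) (e : K).
Hypothesis sK : involutive s.
Hypothesis ee : e * e = 1.
Hypothesis se : s e = e.
Hypothesis conjE : forall a, conj_of c q a = s a.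
Hypothesis BnC : forall n x y, Bn c q eps n y x = e * s (Bn c q eps n x y).
Hypothesis Bn_trace : forall n x, exists t, Bn c q eps n x x = t + e * s t.

Local Notation B := (Bn c q eps).
Local Notation dim := (dimV c).

Definition gram_mx n : 'M[K]_(dim n) :=
  \matrix_(i, j) (coef c eps i * (j == partner c i :> nat)%:R).

Lemma form_row n x y : form s (gram_mx n) (row_of _ x) (row_of _ y) = B n x y.
Proof.
rewrite BnE big_mkord /form /gram -mulmxA mxE; apply: eq_bigr => i _.
rewrite !mxE.
have pi : (partner c i < dim n)%N by rewrite partner_lt.
rewrite (bigD1 (Ordinal pi)) //= big1 => [|j /eqP ji]; last first.
  by rewrite !mxE (_ : _ == _ = false) ?mulr0 ?mul0r //; apply/eqP=> h; apply/ji/val_inj.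
by rewrite !mxE eqxx mulr1 addr0 conjE; ring.
Qed.

Lemma form_vec n (x y : 'rV_(dim n)) : form s (gram_mx n) x y = B n (vec_of x) (vec_of y).
Proof. by rewrite -form_row !vec_ofK. Qed.

Lemma gram_mx_unit n : gram_mx n \in unitmx.
Proof.
rewrite -row_free_unit -kermx_eq0; apply/rowV0P=> v; rewrite sub_kermx => /eqP v0.
apply/rowP=> i; rewrite mxE; apply/eqP; rewrite -(vec_of_lt v).
have : form s (gram_mx n) v (row_of _ (fun j => (j == partner c i)%:R)) = 0.
  by rewrite /form /gram v0 mul0mx mxE.
rewrite -{1}(vec_ofK v) form_row Bn_partner // => /eqP.
by rewrite mulf_eq0 (negPf (coef_neq0 hyp i)).
Qed.

Lemma formC n x y : form s (gram_mx n) y x = e * s (form s (gram_mx n) x y).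
Proof. by rewrite !form_vec BnC. Qed.

Lemma form_trace n x : exists t, form s (gram_mx n) x x = t + e * s t.
Proof. by rewrite form_vec; apply: Bn_trace. Qed.

Lemma Bn_linear_r n a x y z :
  B n z (fun i => a * x i + y i) = s a * B n z x + B n z y.
Proof. by rewrite BnC Bn_linear rmorphD rmorphM mulrDr mulrCA -!BnC. Qed.

(** As [u] is supported in V_n, [B n] computes its pairing in V_infinity with any [w]. *)
Definition orth n (V : vec K -> Prop) (u : vec K) : Prop :=
  (forall i, (dim n <= i)%N -> u i = 0) /\ forall w, V w -> B n u w = 0.

Lemma orthW n m V u : (n <= m)%N -> orth n V u -> orth m V u.
Proof.
move=> nm [u0 uV]; split=> [i mi|w Vw]; first by rewrite u0 // (leq_trans _ mi) ?leq_dimV.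
by rewrite (Bn_supp _ _ _ nm u0) uV.
Qed.

(** [V] contains every basis vector beyond V_n, and these force the coordinates of [u] there to
    vanish. The complement is thus the same at every level from n on. *)
Lemma orth_contains_perp n m V u : (n <= m)%N -> contains_perp c n V ->
  orth m V u -> orth n V u.
Proof.
move=> nm Vn [u0 uV].
have {}u0 i : (dim n <= i)%N -> u i = 0.
  move=> ni; have [im|] := ltnP i (dim m); last exact: u0.
  have Vd : V (fun j => (j == partner c i)%:R).
    apply: Vn => [|j jn].
      by exists (partner c i).+1 => j /gtn_eqF->.
    by case: eqP => // jE; move: jn; rewrite jE partner_lt ltnNge ni.
  have /eqP := uV _ Vd; rewrite Bn_partner // mulf_eq0.
  by rewrite (negPf (coef_neq0 hyp i)) => /eqP.
by split=> // w Vw; rewrite -(Bn_supp _ _ _ nm u0) uV.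
Qed.

(** A vector differs from its truncation by an element of the complement of V_n, which lies in
    [V]. *)
Lemma finsupp_subspace_split n (V : vec K -> Prop) (v : vec K) : subspace V -> contains_perp c n V ->
  finsupp v -> V v <-> V (vec_of (row_of (dim n) v)).
Proof.
move=> [_ V0 VD VZ] Vn [N vN].
have Vr : V (fun i => v i + -1 * vec_of (row_of (dim n) v) i).
  apply: Vn => [|i id].
    by exists (maxn N (dim n)) => i; rewrite geq_max => /andP[/vN-> /vec_of_ge->]; rewrite mulr0 addr0.
  by rewrite (vec_of_lt _ (Ordinal id)) mxE /=; ring.
have E : v = fun i => (v i + -1 * vec_of (row_of (dim n) v) i) + vec_of (row_of (dim n) v) i.
  by apply: functional_extensionality => i; ring.
have E' : vec_of (row_of (dim n) v)
    = fun i => v i + -1 * (v i + -1 * vec_of (row_of (dim n) v) i).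
  by apply: functional_extensionality => i; ring.
split=> h; first by rewrite E'; apply: VD => //; apply: VZ.
by rewrite E; apply: VD.
Qed.

(** Double complement: truncation to V_n reduces the claim to [perpK]. *)
Lemma orth_orth n (V : vec K -> Prop) (v : vec K) : subspace V -> contains_perp c n V -> finsupp v ->
  (forall u, orth n V u -> B n u v = 0) -> V v.
Proof.
move=> sV Vn fv h; apply/(finsupp_subspace_split sV Vn fv).
have [M MV] := subspace_matrix (dim n) sV; apply/MV.
suff : (row_of (dim n) v <= perp s (gram_mx n) (perp s (gram_mx n) M))%MS.
  by rewrite (perpK (gram_mx_unit n) (@formC n)).
rewrite sub_perp; apply/eqP.
apply: (gram_eq0C (@formC n)); apply/colP=> i; rewrite gramE row_id mxE.
rewrite -(vec_ofK (row i _)) form_row; apply: h; split=> [j|w Vw]; first exact: vec_of_ge.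
have /MV/submxP[D wD] : V (vec_of (row_of (dim n) w)).
  have fw : finsupp w by case: sV => + _ _ _; apply.
  exact: (proj1 (finsupp_subspace_split sV Vn fw)).
have /eqP r0 : gram s (gram_mx n) (row i (perp s (gram_mx n) M)) M == 0.
  by rewrite -sub_perp row_sub.
rewrite -form_row vec_ofK wD /form /gram map_mxM trmx_mul mulmxA.
by rewrite [X in X *m _]r0 mul0mx mxE.
Qed.

Lemma orth_subspace n V : subspace (orth n V).
Proof.
split=> [v [v0 _]||v w [v0 vV] [w0 wV]|a v [v0 vV]].
- by exists (dim n).
- by split=> // w _; rewrite BnE big1 // => i _; rewrite mulr0 mul0r.
- split=> [i id|u Vu]; first by rewrite v0 // w0 // addr0.
  have -> : (fun i => v i + w i) = (fun i => 1 * v i + w i).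
    by apply: functional_extensionality => i; rewrite mul1r.
  by rewrite Bn_linear vV // wV // mulr0 addr0.
- split=> [i id|u Vu]; first by rewrite v0 // mulr0.
  have -> : (fun i => a * v i) = (fun i => (a - 1) * v i + v i).
    by apply: functional_extensionality => i; ring.
  by rewrite Bn_linear vV // mulr0 addr0.
Qed.

(** What is used of an element of the group at level m, without its matrix; elements from different
    levels can thus be compared at a common one. *)
Definition stable m (x : vec K -> vec K) : Prop :=
  [/\ forall a v w, x (fun i => a * v i + w i) = fun i => a * x v i + x w i,
      forall v i, (dim m <= i)%N -> x v i = v i,
      forall v, (forall i, (i < dim m)%N -> v i = 0) -> x v = v
    & forall v w, B m (x v) (x w) = B m v w].

Lemma inGn_stable n m x : (n <= m)%N -> inGn c q eps n x -> stable m x.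
Proof.
move=> nm [A [[_ hA] xA]].
have dnm := leq_dimV c nm.
have ge v i : (dim n <= i)%N -> x v i = v i by move=> ni; rewrite xA extend_ge.
split=> [a v w|v i mi|v v0|v w].
- by rewrite !xA extend_linear.
- by rewrite ge // (leq_trans dnm).
- by rewrite xA extend_id // => i id; rewrite v0 // (leq_trans id).
(* Beyond V_n a coordinate and its partner are both untouched, so the extra terms agree. *)
- rewrite !(Bn_split c q eps _ _ nm) {1}(xA v) {1}(xA w) hA; congr (_ + _).
  apply: eq_big_nat => i /andP[ni _]; rewrite !ge //.
  by rewrite leqNgt partner_lt -leqNgt.
Qed.

(** * Transport of complements under a conjugating element *)

Section Transport.

Variables (m : nat) (x xinv : vec K -> vec K) (V V' : vec K -> Prop).
Hypothesis xm : stable m x.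
Hypothesis xK : forall v, xinv (x v) = v.
Hypothesis xVK : forall v, x (xinv v) = v.
Hypothesis xV : forall w, V' w <-> exists v, V v /\ w = x v.

Lemma orth_image u : orth m V u -> orth m V' (x u).
Proof.
case: xm => _ ge _ xB [u0 uV]; split=> [i mi|w /xV[v [Vv ->]]]; first by rewrite ge // u0.
by rewrite xB uV.
Qed.

Lemma orth_preimage u : orth m V' u -> orth m V (xinv u).
Proof.
case: xm => _ ge _ xB [u0 uV]; split=> [i mi|w Vw].
  by rewrite -(ge (xinv u)) // xVK u0.
by rewrite -xB xVK uV //; apply/xV; exists w.
Qed.

(** Although [x] lives at level m, it carries [orth n V] into [orth n V']: pass up to level m, apply
    [x], and come back down. Witt's theorem in V_n is then applied to a basis of [orth n V] and its
    image. *)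
Lemma isometry_on_orth n : (n <= m)%N -> contains_perp c n V' ->
  exists T, isometry s (gram_mx n) T /\
    forall u, orth n V u -> extend T^T u = x u.
Proof.
move=> nm Vn'; have [lin ge zero xB] := xm.
have [M MV] := subspace_matrix (dim n) (orth_subspace n V).
pose f (r : 'rV[K]_(dim n)) := row_of (dim n) (x (vec_of r)).
have f_lin : linear f by move=> a r r'; rewrite /f vec_of_linear lin row_of_linear.
pose F : {linear 'rV[K]_(dim n) -> 'rV[K]_(dim n)} :=
  HB.pack f (GRing.isLinear.Build K _ _ _ f f_lin).
have [k [U [U_free UM]]] : exists k (U : 'M[K]_(k, dim n)), row_free U /\ (U :=: M)%MS.
  by exists (\rank M), (row_base M); split; [exact: row_base_free | exact: eq_row_base].
pose W := U *m lin1_mx F.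
have UV (r : 'rV_(dim n)) : (r <= U)%MS -> orth n V (vec_of r).
  by move=> rU; apply/MV; rewrite -UM.
have xU (r : 'rV_(dim n)) : (r <= U)%MS -> orth n V' (x (vec_of r)).
  by move=> /UV/(orthW nm)/orth_image/(orth_contains_perp nm Vn').
have W_free : row_free W.
  rewrite -kermx_eq0; apply/rowV0P=> a; rewrite sub_kermx mulmxA mul_rV_lin1 => /eqP fa0.
  have [x0 _] := xU (a *m U) (submxMl _ _).
  (* The image vanishes beyond V_n as well, so a zero row means a zero vector, and [x] is
     injective. *)
  have {fa0} x0 : x (vec_of (a *m U)) = x (vec_of (0 : 'rV_(dim n))).
    have v0 : vec_of (0 : 'rV[K]_(dim n)) = fun=> 0.
      by apply: (@eq_vec _ (dim n)) => [i|i /vec_of_ge->//]; rewrite vec_of_lt mxE.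
    rewrite v0 [RHS]zero //; apply: (@eq_vec _ (dim n)) => [i|i /x0//].
    by move/rowP/(_ i): fa0; rewrite !mxE.
  have /(can_inj (@vec_ofK _ _)) : vec_of (a *m U) = vec_of (0 : 'rV_(dim n)).
    by rewrite -[LHS]xK x0 xK.
  move/eqP; rewrite -[0](mul0mx _ U); move/eqP/(row_free_inj U_free); exact.
have UW : gram s (gram_mx n) U U = gram s (gram_mx n) W W.
  apply/matrixP=> i j; rewrite !gramE !row_mul !mul_rV_lin1 /= form_row.
  have [oi oj] := (UV _ (row_sub i U), xU _ (row_sub i U)).
  by rewrite -(Bn_supp _ _ _ nm (proj1 oj)) xB (Bn_supp _ _ _ nm (proj1 oi)) form_vec.
have [T [hT UT]] :=
  witt_extension sK ee se (gram_mx_unit n) (@formC n) (@form_trace n)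
    U_free W_free UW.
exists T; split=> // u ou; have [u0 _] := ou.
have rM : (row_of (dim n) u <= U)%MS by rewrite UM; apply/MV; rewrite row_ofK.
apply: (@eq_vec _ (dim n)) => [i|i ni].
  have : row_of (dim n) (extend T^T u) = row_of (dim n) (x u).
    rewrite row_of_extend -[in RHS](row_ofK u0) -/(f _) -[f _]/(F _) -mul_rV_lin1.
    by case/submxP: rM => D ->; rewrite -!mulmxA UT.
  by move/rowP/(_ i); rewrite !mxE.
rewrite extend_ge //.
by have [xu0 _] := xU _ rM; rewrite u0 // -(xu0 i ni) row_ofK.
Qed.

End Transport.

End StandardForm.

(** * Descent of conjugacy to V_n *)

Theorem theorem7p16 (c : formcase) (q : nat) (K : finFieldType) (eps : K)
    (n : nat) (g g' : vec K -> vec K) (V V' : vec K -> Prop) :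
  case_hyp c q eps ->
  inBP c q eps n g V -> inBP c q eps n g' V' ->
  ((exists x, inGinf c q eps x /\ acts_to x g V g' V') <->
   (exists x, inGn c q eps n x /\ acts_to x g V g' V')).
Proof.
move=> hyp [[[m1 g_m1] [sV _] gV] Vn] [[[m2 g_m2] [sV' _] gV'] Vn'].
split; last by case=> x [xn xa]; exists x; split=> //; exists n.
case=> x [[m0 x_m0] [xinv [xK xVK xg xV]]].
have [s [e [sK [ee se] conjE BnC Bn_trace]]] := form_structure hyp.
(* A common level for V_n, [x], [g] and [g']. *)
pose m := maxn (maxn n m0) (maxn m1 m2).
have nm : (n <= m)%N by rewrite /m; lia.
have xm : stable c q eps m x by apply: inGn_stable x_m0; rewrite /m; lia.
have gm : stable c q eps m g by apply: inGn_stable g_m1; rewrite /m; lia.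
have g'm : stable c q eps m g' by apply: inGn_stable g_m2; rewrite /m; lia.
have [T [hT Tx]] := isometry_on_orth hyp sK ee se conjE BnC Bn_trace xm xK xV nm Vn'.
have uT := isometry_unit (gram_mx_unit hyp conjE n) hT.
pose y := extend T^T; pose yinv := extend (invmx T)^T.
have yK v : yinv (y v) = v by apply: extend_trK; rewrite mulmxV.
have yVK v : y (yinv v) = v by apply: extend_trK; rewrite mulVmx.
have yB v w : Bn c q eps n (y v) (y w) = Bn c q eps n v w.
  by rewrite -!(form_row eps conjE) !row_of_extend hT.
have [xlin xge xid xB] := xm; have [glin gge gid gB] := gm.
have [g'lin _ g'id _] := g'm.
have fin d (T' : 'M[K]_d) v : finsupp v -> finsupp (extend T' v).
  case=> N vN; exists (maxn N d) => i; rewrite geq_max => /andP[Ni di].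
  by rewrite extend_ge // vN.
have fin_stable h v : stable c q eps m h -> finsupp v -> finsupp (h v).
  case=> _ hge _ _ [N vN]; exists (maxn N (dimV c m)) => i; rewrite geq_max => /andP[Ni di].
  by rewrite hge // vN.
have imV' u : orth c q eps n V' u -> exists2 v, orth c q eps n V v & u = x v.
  move=> /(orthW nm)/(orth_preimage xm xVK xV)/(orth_contains_perp hyp nm Vn) ou.
  by exists (xinv u).
have yV v : V v -> V' (y v).
  move=> Vv; apply: (orth_orth hyp conjE BnC sV' Vn').
    by apply: fin; case: sV => + _ _ _; apply.
  (* Each element of the complement of [V'] is x u = y u with [u] orthogonal to [V], so it is
     orthogonal to y v. *)
  by move=> _ /imV'[u ou ->]; rewrite -Tx // yB; apply: (proj2 ou).
have yV' w : V' w -> V (yinv w).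
  move=> Vw; apply: (orth_orth hyp conjE BnC sV Vn).
    by apply: fin; case: sV' => + _ _ _; apply.
  move=> u ou; rewrite -yB yVK /y Tx //.
  have /(orth_contains_perp hyp nm Vn') := orth_image xm xV (orthW nm ou).
  by case=> _; apply.
have yg v : finsupp v -> g' (y v) = y (g v).
  move=> fv.
  (* For w in [V], (gv - v, w) = (gv, gw) - (v, w) = 0. *)
  have ou : orth c q eps n V (fun i => -1 * v i + g v i).
    apply: (orth_contains_perp hyp nm Vn); split=> [i mi|w Vw].
      by rewrite gge //; ring.
    by rewrite Bn_linear -{2}(gV w Vw) gB; ring.
  (* Against xu = yu, the products with yv and xv both equal (u,v). *)
  have V'd : V' (fun i => -1 * x v i + y v i).
    apply: (orth_orth hyp conjE BnC sV' Vn').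
      have [N1 h1] := fin_stable x v xm fv; have [N2 h2] := fin _ T^T v fv.
      exists (maxn N1 N2) => i; rewrite geq_max => /andP[/h1-> /h2 h].
      by rewrite /y h mulr0 addr0.
    move=> _ /imV'[u ou' ->]; rewrite (Bn_linear_r BnC) -{2}(Tx u ou') yB.
    have /(orth_contains_perp hyp nm Vn')[xu0 _] := orth_image xm xV (orthW nm ou').
    rewrite -(Bn_supp _ _ _ nm xu0) xB (Bn_supp _ _ _ nm (proj1 ou')).
    by rewrite rmorphN rmorph1; ring.
  (* [E1] says that g' fixes yv - xv, [E2] that x and y agree on gv - v; combined with xg = g'x they
     give the claim. *)
  have := gV' _ V'd; rewrite g'lin => E1.
  have := Tx _ ou; rewrite extend_linear xlin => E2.
  have xgv : x (g v) = g' (x v) by rewrite xg xK.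
  apply: functional_extensionality => i.
  have {}E1 := congr1 (@^~ i) E1; have {}E2 := congr1 (@^~ i) E2.
  rewrite /= xgv -/(y v) -/(y (g v)) in E1 E2.
  transitivity (g' (x v) i + (-1 * g' (x v) i + g' (y v) i)); first by ring.
  transitivity (y v i + (-1 * y v i + y (g v) i)); last by ring.
  by rewrite E1 E2; ring.
exists y; split.
  exists T^T; split=> //; split; first by rewrite unitmx_tr.
  by move=> v w; apply: yB.
exists yinv; split=> // [v|w].
  (* [v] need not be finitely supported; all the maps involved fix its coordinates beyond V_m. *)
  pose lo := vec_of (row_of (dimV c m) (yinv v)).
  pose hi i := yinv v i - lo i.
  have hi0 i : (i < dimV c m)%N -> hi i = 0.
    by move=> im; rewrite /hi /lo (vec_of_lt _ (Ordinal im)) mxE subrr.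
  have vE : yinv v = fun i => 1 * lo i + hi i.
    by apply: functional_extensionality => i; rewrite /hi; ring.
  have yhi : y hi = hi.
    by apply: extend_id => i id; apply: hi0; apply: leq_trans id _; apply: leq_dimV.
  have flo : finsupp lo by exists (dimV c m) => i; apply: vec_of_ge.
  rewrite -{1}(yVK v) vE glin (gid hi hi0) /y !extend_linear -!/(y _).
  by rewrite yhi g'lin (g'id hi hi0) yg.
split=> [V'w|[v [Vv ->]]]; last exact: yV.
by exists (yinv w); rewrite yVK; split=> //; apply: yV'.
Qed.
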